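(* Let $A$ be a $\mathbb Z$-superalgebra which is free of finite rank over $\mathbb Z$, let $n\ge1$, $d\ge0$, and let $V=A^{\oplus n}$. The natural left action of $S^A(n,d)$ on $V^{\otimes d}$ and the natural right action of the super wreath product $W_d^A$ on $V^{\otimes d}$ commute, and they yield an isomorphism $S^A(n,d)\cong\mathrm{End}_{W_d^A}(V^{\otimes d})$.
   Context: $\mathbb Z_2=\{\bar0,\bar1\}$; $\bar v$ is the parity of a homogeneous element $v$ of a $\mathbb Z_2$-graded module; formulas with parities are for homogeneous elements, extended linearly. Superalgebras are associative, unital, $\mathbb Z_2$-graded. ''Free'' superalgebras have free parity components. Put $[u_1,\dots,u_d;w_1,\dots,w_d]=\sum_{1\le a<c\le d}\bar u_c\bar w_a$. A tensor power of a superalgebra is a superalgebra via $(x_1\otimes\cdots\otimes x_d)(y_1\otimes\cdots\otimes y_d)=(-1)^{[x_1,\dots,x_d;y_1,\dots,y_d]}x_1y_1\otimes\cdots\otimes x_dy_d$. The symmetric group $\mathfrak S_d$ acts on the right on the $d$th tensor power of a superspace by $(v_1\otimes\cdots\otimes v_d)^g=(-1)^{m}v_{g1}\otimes\cdots\otimes v_{gd}$, $m=\sum_{1\le a<c\le d,\ g^{-1}a>g^{-1}c}\bar v_a\bar v_c$. The matrix superalgebra $M_n(A)$ has parity determined by the parity of entries. $S^A(n,d):=\mathrm{Inv}^dM_n(A)=(M_n(A)^{\otimes d})^{\mathfrak S_d}$, a subsuperalgebra of $M_n(A)^{\otimes d}$. The super wreath product is $W_d^A=A^{\otimes d}\rtimes\mathbb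 Z\mathfrak S_d$: as a module $A^{\otimes d}\otimes\mathbb Z\mathfrak S_d$ (with $\mathbb Z\mathfrak S_d$ of parity $\bar0$), containing $A^{\otimes d}$ and $\mathbb Z\mathfrak S_d$ as subsuperalgebras, with $g^{-1}xg=x^g$ for $g\in\mathfrak S_d$, $x\in A^{\otimes d}$. $V=A^{\oplus n}$ is viewed as column vectors: a left $M_n(A)$-supermodule and right $A$-supermodule. $M_n(A)^{\otimes d}$ (hence $S^A(n,d)$) acts on $V^{\otimes d}$ from the left by $(\xi_1\otimes\cdots\otimes\xi_d)(v_1\otimes\cdots\otimes v_d)=(-1)^{[\xi_1,\dots,\xi_d;v_1,\dots,v_d]}\xi_1v_1\otimes\cdots\otimes\xi_dv_d$; $A^{\otimes d}$ acts from the right by $(v_1\otimes\cdots\otimes v_d)(a_1\otimes\cdots\otimes a_d)=(-1)^{[v_1,\dots,v_d;a_1,\dots,a_d]}v_1a_1\otimes\cdots\otimes v_da_d$; together with the right action $vg:=v^g$ of $\mathfrak S_d$ this is the natural right $W_d^A$-action. The isomorphism sends an element of $S^A(n,d)$ to its left action on $V^{\otimes d}$. *)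

(* Defs.v *)
From HB Require Import structures.
From mathcomp Require Import all_boot all_order all_fingroup all_algebra.
From mathcomp Require Import generic_quotient ring_quotient freeg boolp.

Set Implicit Arguments.
Unset Strict Implicit.
Unset Printing Implicit Defensive.

Import GRing.Theory.
Local Open Scope ring_scope.

(* A Z_2-grading is given by the projections [hcomp b] onto the component of
   parity [b] (false = even, true = odd); thus x is homogeneous of parity b
   when [hcomp b x = x]. *)
HB.mixin Record isSuperspace M of GRing.Zmodule M := {
  hcomp : bool -> M -> M;
  hcomp_zmod_morphism : forall b, zmod_morphism (hcomp b);
  hcompK : forall b c x, hcomp b (hcomp c x) = if b == c then hcomp c x else 0;
  hcomp_split : forall x, x = hcomp false x + hcomp true x
}.

#[short(type="superspaceType")]
HB.structure Definition Superspace := {M of isSuperspace M & GRing.Zmodule M}.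

HB.mixin Record isSuperalgebra A of GRing.PzRing A & Superspace A := {
  hcomp_one : hcomp false (1 : A) = 1;
  hcomp_mul : forall b c (x y : A), hcomp b x = x -> hcomp c y = y ->
    hcomp (b (+) c) (x * y) = x * y
}.

#[short(type="superalgType")]
HB.structure Definition Superalgebra :=
  {A of isSuperalgebra A & GRing.PzRing A & Superspace A}.

HB.instance Definition _ (M : superspaceType) b :=
  GRing.isZmodMorphism.Build M M (hcomp b) (@hcomp_zmod_morphism M b).

(* Both parity components are free Z-modules of finite rank. *)
Definition superfree (M : superspaceType) : Prop :=
  forall b : bool, exists r (e : 'I_r -> M),
    (forall i, hcomp b (e i) = e i) /\
    (forall x : M, hcomp b x = x ->
       exists! k : {ffun 'I_r -> int}, x = \sum_i e i *~ k i).

Section SuperspaceTheory.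
Variable M : superspaceType.

Lemma hcomp_id b (x : M) : hcomp b (hcomp b x) = hcomp b x.
Proof. by rewrite hcompK eqxx. Qed.

Lemma hcomp_neq b c (x : M) : hcomp b x = x -> c != b -> hcomp c x = 0.
Proof. by move=> <-; rewrite hcompK => /negPf->. Qed.

Lemma hcomp_sum (x : M) : x = \sum_b hcomp b x.
Proof. by rewrite big_bool /= addrC -hcomp_split. Qed.

Lemma hcomp_eq b (x : M) c : hcomp b x = x -> hcomp c x = if c == b then x else 0.
Proof. by move=> h; case: eqP => [->//|/eqP /(hcomp_neq h)]. Qed.

End SuperspaceTheory.

(* The d-th tensor power over Z of an abelian group M: the free abelian group on
   families 'I_d -> M modulo additivity in each variable. *)
Section TensorPower.
Variable d : nat.

Definition upd (M : Type) (x : {ffun 'I_d -> M}) (i : 'I_d) (a : M) :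
    {ffun 'I_d -> M} :=
  [ffun j => if j == i then a else x j].

Definition multiadd (M N : zmodType) (f : {ffun 'I_d -> M} -> N) : Prop :=
  forall x i a b, f (upd x i (a + b)) = f (upd x i a) + f (upd x i b).

Variable M : zmodType.
Local Notation gen := {ffun 'I_d -> M}.
Local Notation F := {freeg gen / int}.

Definition trel (r : F) : Prop := exists x i a b,
  r = << upd x i (a + b) >> - << upd x i a >> - << upd x i b >>.

(* The subgroup generated by the relations [trel]. *)
Definition tideal : {pred F} := fun r => `[< forall P : F -> Prop,
  P 0 -> (forall s t, P s -> P t -> P (s - t)) ->
  (forall s, trel s -> P s) -> P r >].

Fact tideal_zmod_closed : zmod_closed tideal.
Proof.
split; first by apply/asboolP => P P0 _ _.
move=> s t /asboolP hs /asboolP ht; apply/asboolP => P P0 PB Pr.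
exact: (PB _ _ (hs P P0 PB Pr) (ht P P0 PB Pr)).
Qed.
HB.instance Definition _ := GRing.isZmodClosed.Build F tideal tideal_zmod_closed.

Definition tpow : Type := Quotient.quot tideal.
HB.instance Definition _ := GRing.Zmodule.copy tpow (Quotient.quot tideal).

Definition tens (x : gen) : tpow := \pi_(Quotient.quot tideal)%qT << x >>.

(* The additive map induced by a multiadditive f (junk when f is not). *)
Definition tlift (N : zmodType) (f : gen -> N) (t : tpow) : N :=
  fglift (f : gen -> zmodule N) (repr (t : Quotient.quot tideal)).

End TensorPower.

Section TensorTheory.
Variables (d : nat) (M : zmodType).
Implicit Type x : {ffun 'I_d -> M}.

Lemma tens_multiadd : multiadd (@tens d M).
Proof.
move=> x i a b; rewrite /tens -raddfD /=; apply/eqP.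
rewrite -Quotient.idealrBE; apply/asboolP => P _ _; apply.
by exists x, i, a, b; rewrite opprD addrA.
Qed.

Lemma fglift_modE (N : zmodType) (f : {ffun 'I_d -> M} -> N)
    (r s : {freeg {ffun 'I_d -> M} / int}) :
  multiadd f -> (r = s %[mod (Quotient.quot (@tideal d M))])%qT ->
  fglift (f : _ -> zmodule N) r = fglift (f : _ -> zmodule N) s.
Proof.
move=> fM /eqP; rewrite -Quotient.idealrBE => /asboolP.
move=> /(_ (fun t => fglift (f : _ -> zmodule N) t = 0)) h.
apply: (@subr0_eq (zmodule N)); rewrite -lift_is_additive; apply: h.
- by rewrite -(subrr 0) lift_is_additive subrr.
- by move=> t u ht hu; rewrite lift_is_additive ht hu subrr.
- move=> _ [x [i [a [b ->]]]]; rewrite !lift_is_additive !liftU !scale1r.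
  by rewrite fM addrAC addrK subrr.
Qed.

Lemma tlift_zmod (N : zmodType) (f : {ffun 'I_d -> M} -> N) :
  multiadd f -> zmod_morphism (tlift f).
Proof.
move=> fM s t; rewrite /tlift.
rewrite -[RHS](@lift_is_additive _ _ (zmodule N)); apply: fglift_modE => //.
by rewrite reprK raddfB /= !reprK.
Qed.

Lemma tlift_tens (N : zmodType) (f : {ffun 'I_d -> M} -> N) x :
  multiadd f -> tlift f (tens x) = f x.
Proof.
move=> fM; rewrite /tlift (@fglift_modE _ _ _ << x >>) ?liftU ?scale1r //.
by rewrite reprK.
Qed.

Lemma tpow_ind (P : tpow d M -> Prop) :
  P 0 -> (forall s t, P s -> P t -> P (s - t)) -> (forall x, P (tens x)) ->
  forall t, P t.
Proof.
move=> P0 PB Px t.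
have PN s : P s -> P (- s) by move=> hs; rewrite -sub0r; apply: PB.
have PD s u : P s -> P u -> P (s + u).
  by move=> hs hu; rewrite -[u]opprK; apply: PB => //; apply: PN.
rewrite -[t](reprK (t : Quotient.quot (@tideal d M))).
elim/freeg_ind_dom0: (repr _) => [|k x D _ _ IH]; first by rewrite raddf0.
rewrite raddfD; apply: (PD) => //.
have -> : << k *g x >> = << x >> *~ k :> {freeg {ffun 'I_d -> M} / int}.
  by rewrite freeg_mulz intz.
rewrite raddfMz; change (P (tens x *~ k)).
have Pn (n : nat) : P (tens x *+ n).
  by elim: n => [|n IHn]; rewrite ?mulr0n // mulrS; apply: (PD).
by case: k => n; rewrite ?NegzE ?mulrNz; [apply: Pn | apply/PN/Pn].
Qed.

Lemma upd_upd x i a b : upd (upd x i a) i b = upd x i b.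
Proof. by apply/ffunP => j; rewrite !ffunE; case: eqP. Qed.

Lemma upd_id x i : upd x i (x i) = x.
Proof. by apply/ffunP => j; rewrite !ffunE; case: eqP => [->|]. Qed.

Lemma multiadd0 (N : zmodType) (f : {ffun 'I_d -> M} -> N) x i :
  multiadd f -> x i = 0 -> f x = 0.
Proof.
move=> fM x0; have := fM x i 0 0; rewrite addr0 -{1 2 3}x0 upd_id.
by rewrite -{1}[f x]addr0 => /addrI/esym.
Qed.

End TensorTheory.

Section Hext.
Variable d : nat.

Definition hpart (M : superspaceType) (u : {ffun 'I_d -> bool})
    (x : {ffun 'I_d -> M}) : {ffun 'I_d -> M} :=
  [ffun i => hcomp (u i) (x i)].

(* The linear extension of a formula [f u x] for tensors of homogeneous
   elements x i of parity u i. *)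
Definition hext (M : superspaceType) (N : zmodType)
    (f : {ffun 'I_d -> bool} -> {ffun 'I_d -> M} -> N) : tpow d M -> N :=
  tlift (fun x => \sum_u f u (hpart u x)).

Section Theory.
Variables (M : superspaceType) (N : zmodType).
Implicit Type f : {ffun 'I_d -> bool} -> {ffun 'I_d -> M} -> N.

Lemma hpart_upd u (x : {ffun 'I_d -> M}) i a :
  hpart u (upd x i a) = upd (hpart u x) i (hcomp (u i) a).
Proof. by apply/ffunP => j; rewrite !ffunE; case: eqP => [->|]. Qed.

Lemma hext_multiadd f : (forall u, multiadd (f u)) ->
  multiadd (fun x => \sum_u f u (hpart u x)).
Proof.
move=> fM x i a b; rewrite -big_split; apply: eq_bigr => u _ /=.
by rewrite !hpart_upd raddfD fM.
Qed.

Lemma hext_zmod f : (forall u, multiadd (f u)) -> zmod_morphism (hext f).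
Proof. by move=> fM; apply/tlift_zmod/hext_multiadd. Qed.

Lemma hext0 f : (forall u, multiadd (f u)) -> hext f 0 = 0.
Proof. by move=> /hext_zmod h; have := h 0 0; rewrite !subrr. Qed.

Lemma hextN f t : (forall u, multiadd (f u)) -> hext f (- t) = - hext f t.
Proof. by move=> fM; have := hext_zmod fM 0 t; rewrite hext0 // !sub0r. Qed.

Lemma hextD f s t : (forall u, multiadd (f u)) ->
  hext f (s + t) = hext f s + hext f t.
Proof. by move=> fM; rewrite -{1}[t]opprK hext_zmod // hextN // opprK. Qed.

Lemma hextE f u (x : {ffun 'I_d -> M}) : (forall u, multiadd (f u)) ->
  hpart u x = x -> hext f (tens x) = f u x.
Proof.
move=> fM xu; rewrite /hext tlift_tens; last exact: hext_multiadd.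
rewrite (bigD1 u) //= xu big1 ?addr0 // => w wu.
have [i wi] : exists i, w i != u i.
  apply/existsP; rewrite -negb_forall; apply: contraNN wu.
  by move=> /forallP h; apply/eqP/ffunP => i; apply/eqP.
apply: (@multiadd0 _ _ _ _ _ i) => //.
by rewrite ffunE -xu ffunE hcompK (negPf wi).
Qed.

Lemma tpow_hind (P : tpow d M -> Prop) :
  P 0 -> (forall s t, P s -> P t -> P (s - t)) ->
  (forall u x, hpart u x = x -> P (tens x)) -> forall t, P t.
Proof.
move=> P0 PB Px; apply: tpow_ind => // x.
have PD s u : P s -> P u -> P (s + u).
  move=> hs hu; rewrite -[u]opprK; apply: (PB) => //.
  by rewrite -sub0r; apply: (PB).
suff H (s : seq 'I_d) : forall x : {ffun 'I_d -> M},
    (forall i, i \notin s -> exists b, hcomp b (x i) = x i) -> P (tens x).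
  by apply: (H (enum 'I_d)) => i; rewrite mem_enum.
elim: s => [|i s IHs] {}x hx.
  have hb i : {b | hcomp b (x i) = x i} by apply/cid/hx.
  apply: (Px [ffun i => sval (hb i)]); apply/ffunP => i; rewrite !ffunE.
  exact: (svalP (hb i)).
rewrite -(upd_id x i) (hcomp_split (x i)) tens_multiadd.
by apply: (PD); apply: IHs => j js; rewrite ffunE;
   case: eqP => [_|/eqP ji]; try (by eexists; exact: hcomp_id);
   apply: hx; rewrite inE negb_or ji.
Qed.

Lemma multiadd_comp (N' : zmodType) (f : {ffun 'I_d -> M} -> N) (h : N -> N') :
  {morph h : x y / x + y} -> multiadd f -> multiadd (h \o f).
Proof. by move=> hD fM x i a b; rewrite /= fM hD. Qed.

End Theory.

(* [u_1,...,u_d; w_1,...,w_d] *)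
Definition sgn2 (u w : {ffun 'I_d -> bool}) : nat :=
  \sum_(a < d) \sum_(c < d | (a < c)%N) (u c * w a)%N.

(* The exponent m in (v_1 (x) ... (x) v_d)^g. *)
Definition sgnp (g : 'S_d) (u : {ffun 'I_d -> bool}) : nat :=
  \sum_(a < d) \sum_(c < d | (a < c)%N && ((g^-1)%g c < (g^-1)%g a)%N)
     (u a * u c)%N.

(* The map M^{(x)d} x N^{(x)d} -> P^{(x)d} induced, with the sign rule, by a
   biadditive map M x N -> P. *)
Definition tmul (M N : superspaceType) (P : zmodType) (B : M -> N -> P)
    (s : tpow d M) (t : tpow d N) : tpow d P :=
  hext (fun u x => hext (fun w y =>
    tens [ffun i => B (x i) (y i)] *~ (-1) ^+ sgn2 u w) t) s.

(* t^g *)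
Definition tact (M : superspaceType) (g : 'S_d) (t : tpow d M) : tpow d M :=
  hext (fun u x => tens [ffun i => x (g i)] *~ (-1) ^+ sgnp g u) t.

Definition thcomp (M : superspaceType) (b : bool) (t : tpow d M) : tpow d M :=
  hext (fun u x => if \big[addb/false]_i u i == b then tens x else 0) t.

End Hext.

Section SignRules.
Variable d : nat.
Implicit Types (u w z : {ffun 'I_d -> bool}) (g h : 'S_d).

Definition xs2 (F : 'I_d -> 'I_d -> bool) :=
  \big[addb/false]_(p : 'I_d * 'I_d) F p.1 p.2.

Definition paradd u w : {ffun 'I_d -> bool} := [ffun i => u i (+) w i].
Definition parperm g u : {ffun 'I_d -> bool} := [ffun i => u (g i)].

Lemma odd_sum (I : Type) (r : seq I) (P : pred I) (F : I -> nat) :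
  odd (\sum_(i <- r | P i) F i) = \big[addb/false]_(i <- r | P i) odd (F i).
Proof. by apply: big_morph => // x y; rewrite oddD. Qed.

Lemma odd_pair (P : 'I_d -> 'I_d -> bool) (f : 'I_d -> 'I_d -> nat) :
  odd (\sum_(a < d) \sum_(c < d | P a c) f a c) =
  xs2 (fun a c => P a c && odd (f a c)).
Proof.
rewrite odd_sum /xs2 -(pair_bigA _ (fun a c => P a c && odd (f a c))) /=.
apply: eq_bigr => a _; rewrite odd_sum big_mkcond; apply: eq_bigr => c _.
by case: (P a c).
Qed.

Lemma odd_sgn2 u w : odd (sgn2 u w) = xs2 (fun a c => [&& (a < c)%N, u c & w a]).
Proof.
rewrite odd_pair; apply: eq_bigr => p _; congr (_ && _).
by rewrite oddM !oddb.
Qed.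

Lemma odd_sgnp g u : odd (sgnp g u) =
  xs2 (fun a c => ((a < c) && ((g^-1)%g c < (g^-1)%g a))%N && (u a && u c)).
Proof.
rewrite odd_pair; apply: eq_bigr => p _; congr (_ && _).
by rewrite oddM !oddb.
Qed.

Lemma xs2D F G : xs2 F (+) xs2 G = xs2 (fun a c => F a c (+) G a c).
Proof. by rewrite /xs2 big_split. Qed.

Lemma eq_xs2 F G : (forall a c, F a c = G a c) -> xs2 F = xs2 G.
Proof. by move=> h; apply: eq_bigr => p _. Qed.

Lemma xs2_swap F : xs2 F = xs2 (fun a c => F c a).
Proof.
rewrite /xs2 (reindex_inj (h := fun p : 'I_d * 'I_d => (p.2, p.1))) //=.
by move=> [a c] [b e] [-> ->].
Qed.

Lemma xs2_perm g F : xs2 F = xs2 (fun a c => F (g a) (g c)).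
Proof.
rewrite /xs2 (reindex_inj (h := fun p : 'I_d * 'I_d => (g p.1, g p.2))) //=.
by move=> [a c] [b e] [/perm_inj-> /perm_inj->].
Qed.

Lemma xs2_sym F : (forall a, F a a = false) -> (forall a c, F a c = F c a) ->
  xs2 F = false.
Proof.
move=> F0 Fs.
have -> : xs2 F = xs2 (fun a c => (a < c)%N && F a c) (+)
                 xs2 (fun a c => (c < a)%N && F a c).
  rewrite xs2D; apply: eq_xs2 => a c.
  by case: ltngtP => [||/ord_inj->]; rewrite ?F0 //= ?addbF.
rewrite [X in _ (+) X]xs2_swap xs2D /xs2 big1 // => -[a c] _ /=.
by rewrite (Fs c) addbb.
Qed.

Lemma ltn_opp (a c : 'I_d) : a != c -> (c < a)%N = ~~ (a < c)%N.
Proof.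
move=> ac; rewrite -leqNgt ltn_neqAle eq_sym -(inj_eq val_inj) in ac *.
by rewrite ac.
Qed.

Lemma sgn2A u w z : odd (sgn2 u w) (+) odd (sgn2 (paradd u w) z) =
  odd (sgn2 u (paradd w z)) (+) odd (sgn2 w z).
Proof.
rewrite !odd_sgn2 !xs2D; apply: eq_xs2 => a c; rewrite !ffunE.
by case: (a < c)%N => //=; case: (u c); case: (w a); case: (w c); case: (z a).
Qed.

Lemma xs2_eq F G : xs2 (fun a c => F a c (+) G a c) = false -> xs2 F = xs2 G.
Proof. by rewrite -xs2D; case: (xs2 F); case: (xs2 G). Qed.

Lemma sgn2_perm g u w :
  odd (sgnp g u) (+) odd (sgnp g w) (+) odd (sgn2 (parperm g u) (parperm g w)) =
  odd (sgn2 u w) (+) odd (sgnp g (paradd u w)).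
Proof.
pose inv (a c : 'I_d) := ((a < c) && ((g^-1)%g c < (g^-1)%g a))%N.
have -> : odd (sgn2 (parperm g u) (parperm g w)) =
    xs2 (fun a c => [&& ((g^-1)%g a < (g^-1)%g c)%N, u c & w a]).
  rewrite odd_sgn2 (xs2_perm (g^-1)%g); apply: eq_xs2 => a c.
  by rewrite !ffunE !permKV.
have -> : odd (sgnp g (paradd u w)) = odd (sgnp g u) (+) odd (sgnp g w) (+)
    (xs2 (fun a c => inv c a && (u c && w a)) (+)
     xs2 (fun a c => inv a c && (w a && u c))).
  rewrite [xs2 (fun a c => inv c a && _)]xs2_swap !odd_sgnp !xs2D.
  apply: eq_xs2 => a c; rewrite !ffunE -/(inv a c).
  by case: (inv a c); case: (u a); case: (u c); case: (w a); case: (w c).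
rewrite addbCA; congr (_ (+) _).
rewrite odd_sgn2 !xs2D; apply: eq_xs2 => a c; rewrite /inv.
have [->|ac] := eqVneq a c; first by rewrite !ltnn.
have gac : (g^-1)%g a != (g^-1)%g c by rewrite (inj_eq perm_inj).
rewrite (ltn_opp ac) (ltn_opp gac).
by do 2 case: (_ < _)%N => //=; case: (u c); case: (w a).
Qed.

Lemma sgnpM g h u :
  odd (sgnp (h * g)%g u) = odd (sgnp g u) (+) odd (sgnp h (parperm g u)).
Proof.
have -> : odd (sgnp h (parperm g u)) = xs2 (fun a c =>
    (((g^-1)%g a < (g^-1)%g c) && (((h * g)^-1)%g c < ((h * g)^-1)%g a))%N
      && (u a && u c)).
  rewrite odd_sgnp (xs2_perm (g^-1)%g); apply: eq_xs2 => a c.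
  by rewrite !ffunE !permKV invMg !permM.
rewrite !odd_sgnp xs2D; apply: xs2_eq; rewrite invMg.
apply: xs2_sym => [a|a c]; first by rewrite !ltnn.
have [->//|ac] := eqVneq a c.
have gac : (g^-1)%g a != (g^-1)%g c by rewrite (inj_eq perm_inj).
have kac : (g^-1 * h^-1)%g a != (g^-1 * h^-1)%g c by rewrite (inj_eq perm_inj).
rewrite (ltn_opp ac) (ltn_opp gac) (ltn_opp kac) [u c && _]andbC.
by do 3 case: (_ < _)%N => //=; case: (u a && u c).
Qed.

Lemma sgnp1 u : sgnp 1 u = 0%N.
Proof.
rewrite /sgnp big1 // => a _; rewrite big1 // => c.
by rewrite invg1 !perm1 => /andP[]; case: ltngtP.
Qed.

Lemma xorpar_add u w : \big[addb/false]_i paradd u w i =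
  (\big[addb/false]_i u i) (+) (\big[addb/false]_i w i).
Proof. by rewrite -big_split; apply: eq_bigr => i _; rewrite ffunE. Qed.

Lemma xorpar_perm g u : \big[addb/false]_i parperm g u i = \big[addb/false]_i u i.
Proof.
rewrite [RHS](reindex_inj (@perm_inj _ g)); apply: eq_bigr => i _.
by rewrite ffunE.
Qed.

End SignRules.

Lemma zm_comp (U V W : zmodType) (g : V -> W) (f : U -> V) :
  zmod_morphism g -> zmod_morphism f -> zmod_morphism (fun x => g (f x)).
Proof. by move=> gD fD x y; rewrite fD gD. Qed.

Lemma zm_mulrz (U V : zmodType) (f : U -> V) k :
  zmod_morphism f -> zmod_morphism (fun x => f x *~ k).
Proof. by move=> fD x y; rewrite fD mulrzBl. Qed.

Lemma zm0 (U V : zmodType) (f : U -> V) : zmod_morphism f -> f 0 = 0.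
Proof. by move=> fD; have := fD 0 0; rewrite !subrr. Qed.

Lemma zmN (U V : zmodType) (f : U -> V) x : zmod_morphism f -> f (- x) = - f x.
Proof. by move=> fD; have := fD 0 x; rewrite zm0 // !sub0r. Qed.

Lemma zmD (U V : zmodType) (f : U -> V) x y :
  zmod_morphism f -> f (x + y) = f x + f y.
Proof. by move=> fD; have := fD x (- y); rewrite !opprK (zmN y fD) opprK. Qed.

Lemma zmMz (U V : zmodType) (f : U -> V) x k :
  zmod_morphism f -> f (x *~ k) = f x *~ k.
Proof.
move=> fD; have fn n : f (x *+ n) = f x *+ n.
  by elim: n => [|n IH]; rewrite ?mulr0n ?(zm0 fD) // !mulrS (zmD _ _ fD) IH.
by case: k => n; [exact: fn | rewrite NegzE !mulrNz (zmN _ fD); congr (- _); exact: fn].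
Qed.

Lemma zm_sum (U V : zmodType) (f : U -> V) (I : Type) (r : seq I) (P : pred I)
    (F : I -> U) :
  zmod_morphism f -> f (\sum_(i <- r | P i) F i) = \sum_(i <- r | P i) f (F i).
Proof.
by move=> fD; apply: big_morph; [move=> x y; exact: zmD | exact: zm0].
Qed.

Lemma eq_sgn (V : zmodType) (x : V) m n : odd m = odd n ->
  x *~ (-1) ^+ m = x *~ (-1) ^+ n.
Proof. by move=> h; rewrite -signr_odd h signr_odd. Qed.

Section TensorMul.
Variable d : nat.

Lemma tpow_eq (M : superspaceType) (N : zmodType) (f g : tpow d M -> N) :
  zmod_morphism f -> zmod_morphism g ->
  (forall u x, hpart u x = x -> f (tens x) = g (tens x)) -> f =1 g.
Proof.
move=> fD gD h; apply: tpow_hind => [|s t es et|]; last exact: h.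
  by rewrite (zm0 fD) (zm0 gD).
by rewrite fD gD es et.
Qed.

Definition evenbiadd (M N P : superspaceType) (B : M -> N -> P) : Prop :=
  [/\ forall y, zmod_morphism (B^~ y), forall x, zmod_morphism (B x) &
   forall b c x y, hcomp b x = x -> hcomp c y = y ->
     hcomp (b (+) c) (B x y) = B x y].

Section Bil.
Variables (M N P : superspaceType) (B : M -> N -> P).
Hypothesis BE : evenbiadd B.
Implicit Types (x : {ffun 'I_d -> M}) (y : {ffun 'I_d -> N}).

Let bx x y : {ffun 'I_d -> P} := [ffun i => B (x i) (y i)].

Let bxl x y i a : bx (upd x i a) y = upd (bx x y) i (B a (y i)).
Proof. by apply/ffunP => j; rewrite !ffunE; case: eqP => [->|]. Qed.

Let bxr x y i a : bx x (upd y i a) = upd (bx x y) i (B (x i) a).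
Proof. by apply/ffunP => j; rewrite !ffunE; case: eqP => [->|]. Qed.

Let bmr k x : multiadd (fun y => tens (bx x y) *~ k).
Proof.
case: BE => _ Br _ y i a b; rewrite !bxr (zmD _ _ (Br _)) tens_multiadd.
exact: mulrzDl.
Qed.

Let inner u t x := hext (fun w y => tens (bx x y) *~ (-1) ^+ sgn2 u w) t.

Let inner_ma u t : multiadd (inner u t).
Proof.
move=> x i a b; move: t; apply: tpow_eq.
- by apply: hext_zmod => w; apply: bmr.
- move=> s t /=; rewrite /inner !hext_zmod; try by move=> w; apply: bmr.
  by rewrite opprD addrACA.
- move=> w y yw; rewrite /inner !(hextE _ yw); try by move=> ?; apply: bmr.
  case: BE => Bl _ _; rewrite !bxl (zmD _ _ (Bl _)) tens_multiadd.
  exact: mulrzDl.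
Qed.

Lemma tmul_zml (t : tpow d N) : zmod_morphism (fun s => tmul B s t).
Proof. by apply: hext_zmod => u; apply: inner_ma. Qed.

Lemma tmul_zmr (s : tpow d M) : zmod_morphism (tmul B s).
Proof.
move=> t t'; move: s; apply: tpow_eq.
- exact: tmul_zml.
- by move=> s s'; rewrite !tmul_zml !opprD addrACA.
- move=> u x xu; rewrite /tmul !(hextE _ xu); try by move=> w; apply: inner_ma.
  by apply: hext_zmod => w; apply: bmr.
Qed.

Lemma tmulE u w x y : hpart u x = x -> hpart w y = y ->
  tmul B (tens x) (tens y) = tens (bx x y) *~ (-1) ^+ sgn2 u w.
Proof.
move=> xu yw; rewrite /tmul (hextE _ xu); last by move=> ?; apply: inner_ma.
by rewrite (hextE _ yw) // => ?; apply: bmr.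
Qed.

Lemma hpart_bx u w x y : hpart u x = x -> hpart w y = y ->
  hpart (paradd u w) (bx x y) = bx x y.
Proof.
move=> /ffunP xu /ffunP yw; apply/ffunP => i; rewrite !ffunE.
by case: BE => _ _; apply; [have := xu i | have := yw i]; rewrite ffunE.
Qed.

End Bil.

Lemma tmulA (M N P Q L R : superspaceType)
    (B1 : M -> N -> P) (B2 : P -> Q -> R) (B3 : N -> Q -> L) (B4 : M -> L -> R) :
  evenbiadd B1 -> evenbiadd B2 -> evenbiadd B3 -> evenbiadd B4 ->
  (forall x y z, B2 (B1 x y) z = B4 x (B3 y z)) ->
  forall (s : tpow d M) (t : tpow d N) (q : tpow d Q),
    tmul B2 (tmul B1 s t) q = tmul B4 s (tmul B3 t q).
Proof.
move=> E1 E2 E3 E4 BA s t q; move: s; apply: tpow_eq.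
- by apply: (zm_comp (tmul_zml E2 q)); apply: tmul_zml.
- exact: tmul_zml.
move=> u x xu; move: t; apply: tpow_eq.
- by apply: (zm_comp (tmul_zml E2 q)); apply: tmul_zmr.
- by apply: (zm_comp (tmul_zmr E4 _)); apply: tmul_zml.
move=> w y yw; move: q; apply: tpow_eq.
- exact: tmul_zmr.
- by apply: (zm_comp (tmul_zmr E4 _)); apply: tmul_zmr.
move=> v z zv.
rewrite (tmulE E1 xu yw) (tmulE E3 yw zv).
rewrite (zmMz _ _ (tmul_zml E2 _)) (zmMz _ _ (tmul_zmr E4 _)).
rewrite (tmulE E2 (hpart_bx E1 xu yw) zv) (tmulE E4 xu (hpart_bx E3 yw zv)).
rewrite -!mulrzA -!exprD.
set X := [ffun i => _]; set Y := [ffun i => _].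
have -> : X = Y by apply/ffunP => i; rewrite !ffunE BA.
by apply: eq_sgn; rewrite !oddD addbC sgn2A.
Qed.

Section Act.
Variable M : superspaceType.
Implicit Types (t : tpow d M) (x : {ffun 'I_d -> M}).

Let xg (g : 'S_d) x : {ffun 'I_d -> M} := [ffun i => x (g i)].

Let tact_ma g k : multiadd (fun x => tens (xg g x) *~ k).
Proof.
move=> x i a b; rewrite -mulrzDl.
have E c : xg g (upd x i c) = upd (xg g x) ((g^-1)%g i) c.
  by apply/ffunP => j; rewrite !ffunE (can2_eq (permK g) (permKV g)).
by rewrite !E tens_multiadd.
Qed.

Lemma tact_zm g : zmod_morphism (@tact d M g).
Proof. by apply: hext_zmod => u; apply: tact_ma. Qed.

Lemma tactE g u x : hpart u x = x ->
  tact g (tens x) = tens (xg g x) *~ (-1) ^+ sgnp g u.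
Proof. by move=> xu; rewrite /tact (hextE _ xu) // => w; apply: tact_ma. Qed.

Lemma hpart_xg g u x : hpart u x = x -> hpart (parperm g u) (xg g x) = xg g x.
Proof.
move=> /ffunP xu; apply/ffunP => i; rewrite !ffunE.
by have := xu (g i); rewrite ffunE.
Qed.

Lemma tact1 t : tact 1 t = t.
Proof.
move: t; apply: tpow_eq => [||u x xu] //; first exact: tact_zm.
rewrite (tactE _ xu) sgnp1 expr0 mulr1z; congr tens.
by apply/ffunP => i; rewrite ffunE perm1.
Qed.

Lemma tactM g h t : tact h (tact g t) = tact (h * g)%g t.
Proof.
move: t; apply: tpow_eq => [||u x xu]; last 1 first.
- rewrite !(tactE _ xu) (zmMz _ _ (tact_zm _)) (tactE _ (hpart_xg g xu)).
  rewrite -mulrzA -exprD.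
  have -> : xg h (xg g x) = xg (h * g)%g x.
    by apply/ffunP => i; rewrite !ffunE permM.
  by apply: eq_sgn; rewrite oddD sgnpM addbC.
- by apply: (zm_comp (tact_zm h)); apply: tact_zm.
- exact: tact_zm.
Qed.

Let hc_ma b (u : {ffun 'I_d -> bool}) :
  multiadd (fun x => if \big[addb/false]_i u i == b then tens x else 0).
Proof.
by move=> x i a c; case: (_ == b); rewrite ?addr0 // tens_multiadd.
Qed.

Lemma thcomp_zm b : zmod_morphism (@thcomp d M b).
Proof. by apply: hext_zmod => u; apply: hc_ma. Qed.

Lemma thcompE b u x : hpart u x = x ->
  thcomp b (tens x) = if \big[addb/false]_i u i == b then tens x else 0.
Proof. by move=> xu; rewrite /thcomp (hextE _ xu) // => w; apply: hc_ma. Qed.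

Fact thcompK b c t : thcomp b (thcomp c t) = if b == c then thcomp c t else 0.
Proof.
move: t; apply: tpow_eq => [||u x xu].
- by apply: (zm_comp (thcomp_zm b)); apply: thcomp_zm.
- by case: (b == c) => s t; rewrite ?subr0 // thcomp_zm.
rewrite !(thcompE _ xu).
case: eqP => [uc|_]; last by rewrite (zm0 (thcomp_zm b)) if_same.
by rewrite (thcompE _ xu) uc eq_sym; case: eqP => // ->.
Qed.

Fact thcomp_split t : t = thcomp false t + thcomp true t.
Proof.
move: t; apply: tpow_eq => // [s t|u x xu].
  by rewrite !thcomp_zm opprD addrACA.
by rewrite !(thcompE _ xu); case: (bigop _ _ _); rewrite ?addr0 ?add0r.
Qed.

HB.instance Definition _ := isSuperspace.Build (tpow d M)
  thcomp_zm thcompK thcomp_split.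

Lemma tact_hcomp g b t : hcomp b (tact g t) = tact g (hcomp b t).
Proof.
change (thcomp b (tact g t) = tact g (thcomp b t)).
move: t; apply: tpow_eq => [||u x xu].
- by apply: (zm_comp (thcomp_zm b)); apply: tact_zm.
- by apply: (zm_comp (tact_zm g)); apply: thcomp_zm.
rewrite (tactE _ xu) (zmMz _ _ (thcomp_zm _)) (thcompE _ xu).
rewrite (thcompE _ (hpart_xg g xu)) xorpar_perm.
by case: eqP => _; rewrite ?(tactE _ xu) ?(zm0 (tact_zm g)) ?mul0rz.
Qed.

End Act.

Section BilAct.
Variables (M N P : superspaceType) (B : M -> N -> P).
Hypothesis BE : evenbiadd B.

Lemma tact_tmul g (s : tpow d M) (t : tpow d N) :
  tact g (tmul B s t) = tmul B (tact g s) (tact g t).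
Proof.
move: s; apply: tpow_eq.
- by apply: (zm_comp (tact_zm g)); apply: tmul_zml.
- by apply: (zm_comp (tmul_zml BE _)); apply: tact_zm.
move=> u x xu; move: t; apply: tpow_eq.
- by apply: (zm_comp (tact_zm g)); apply: tmul_zmr.
- by apply: (zm_comp (tmul_zmr BE _)); apply: tact_zm.
move=> w y yw; rewrite (tmulE BE xu yw) (zmMz _ _ (tact_zm g)).
rewrite (tactE g xu) (tactE g yw) (tactE g (hpart_bx BE xu yw)).
rewrite (zmMz _ _ (tmul_zml BE _)) (zmMz _ _ (tmul_zmr BE _)).
rewrite (tmulE BE (hpart_xg g xu) (hpart_xg g yw)).
rewrite -!mulrzA -!exprD.
set X := [ffun i => _]; set Y := [ffun i => _].
have -> : X = Y by apply/ffunP => i; rewrite !ffunE.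
apply: eq_sgn; move: (sgn2_perm g u w); rewrite !oddD.
by do 5 case: (odd _).
Qed.

Lemma tmul_even b c (s : tpow d M) (t : tpow d N) :
  hcomp b s = s -> hcomp c t = t -> hcomp (b (+) c) (tmul B s t) = tmul B s t.
Proof.
move=> <- <-; change (thcomp (b (+) c) (tmul B (thcomp b s) (thcomp c t)) =
  tmul B (thcomp b s) (thcomp c t)).
move: s; apply: tpow_eq.
- apply: (zm_comp (thcomp_zm _)); apply: (zm_comp (tmul_zml BE _)).
  exact: thcomp_zm.
- by apply: (zm_comp (tmul_zml BE _)); apply: thcomp_zm.
move=> u x xu; move: t; apply: tpow_eq.
- apply: (zm_comp (thcomp_zm _)); apply: (zm_comp (tmul_zmr BE _)).
  exact: thcomp_zm.
- by apply: (zm_comp (tmul_zmr BE _)); apply: thcomp_zm.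
move=> w y yw; rewrite (thcompE b xu) (thcompE c yw).
case: eqP => [ub|_]; last by rewrite (zm0 (tmul_zml BE _)) (zm0 (thcomp_zm _)).
case: eqP => [wc|_]; last by rewrite (zm0 (tmul_zmr BE _)) (zm0 (thcomp_zm _)).
rewrite (tmulE BE xu yw) (zmMz _ _ (thcomp_zm _)).
by rewrite (thcompE _ (hpart_bx BE xu yw)) xorpar_add ub wc eqxx.
Qed.

Lemma tmul_biadd : evenbiadd (tmul B : tpow d M -> tpow d N -> tpow d P).
Proof. by split; [exact: tmul_zml | exact: tmul_zmr | exact: tmul_even]. Qed.

End BilAct.
End TensorMul.

Section TensorAlgebra.
Variables (d : nat) (A : superalgType).

Lemma mul_biadd : evenbiadd ( *%R : A -> A -> A).
Proof.
split=> [y x x'|x y y'|b c x y]; [exact: mulrBl | exact: mulrBr |].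
exact: hcomp_mul.
Qed.

Definition tone : tpow d A := tens [ffun=> 1].

Lemma hpart_one :
  hpart [ffun=> false] [ffun=> 1 : A] = [ffun=> 1] :> {ffun 'I_d -> A}.
Proof. by apply/ffunP => i; rewrite !ffunE hcomp_one. Qed.

Lemma sgn20l (u : {ffun 'I_d -> bool}) : sgn2 [ffun=> false] u = 0%N.
Proof. by rewrite /sgn2 big1 // => a _; rewrite big1 // => c _; rewrite ffunE. Qed.

Lemma sgn20r (u : {ffun 'I_d -> bool}) : sgn2 u [ffun=> false] = 0%N.
Proof.
by rewrite /sgn2 big1 // => a _; rewrite big1 // => c _; rewrite ffunE muln0.
Qed.

Lemma tone_l (M : superspaceType) (B : A -> M -> M) :
  evenbiadd B -> (forall x, B 1 x = x) -> forall t, tmul B tone t = t.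
Proof.
move=> BE B1; apply: tpow_eq => // [|u x xu]; first exact: tmul_zmr.
rewrite (tmulE BE hpart_one xu) sgn20l; congr tens.
by apply/ffunP => i; rewrite !ffunE B1.
Qed.

Lemma tone_r (M : superspaceType) (B : M -> A -> M) :
  evenbiadd B -> (forall x, B x 1 = x) -> forall t, tmul B t tone = t.
Proof.
move=> BE B1; apply: tpow_eq => // [|u x xu]; first exact: tmul_zml.
rewrite (tmulE BE xu hpart_one) sgn20r; congr tens.
by apply/ffunP => i; rewrite !ffunE B1.
Qed.

Lemma tact_one g : tact g tone = tone.
Proof.
rewrite /tone (tactE g hpart_one) (_ : sgnp _ _ = 0%N); last first.
  by rewrite /sgnp big1 // => a _; rewrite big1 // => c _; rewrite !ffunE.
by congr tens; apply/ffunP => i; rewrite !ffunE.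
Qed.

Definition tring_mul : tpow d A -> tpow d A -> tpow d A := tmul *%R.

Fact tring_mulA : associative tring_mul.
Proof.
move=> s t q; apply/esym; apply: tmulA; try exact: mul_biadd.
by move=> x y z; rewrite mulrA.
Qed.
Fact tring_mul1l : left_id tone tring_mul.
Proof. exact: (tone_l mul_biadd (@mul1r A)). Qed.
Fact tring_mul1r : right_id tone tring_mul.
Proof. exact: (tone_r mul_biadd (@mulr1 A)). Qed.
Fact tring_mulDl : left_distributive tring_mul +%R.
Proof. by move=> s t q; apply: (zmD _ _ (tmul_zml mul_biadd _)). Qed.
Fact tring_mulDr : right_distributive tring_mul +%R.
Proof. by move=> s t q; apply: (zmD _ _ (tmul_zmr mul_biadd _)). Qed.

HB.instance Definition _ := GRing.Zmodule_isPzRing.Build (tpow d A)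
  tring_mulA tring_mul1l tring_mul1r tring_mulDl tring_mulDr.

Fact tring_hcomp1 : hcomp false (1 : tpow d A) = 1.
Proof.
change (thcomp false tone = tone); rewrite /tone (thcompE _ hpart_one) big1 //.
by move=> i _; rewrite ffunE.
Qed.
Fact tring_hcompM b c (x y : tpow d A) : hcomp b x = x -> hcomp c y = y ->
  hcomp (b (+) c) (x * y) = x * y.
Proof. exact: (tmul_even mul_biadd). Qed.

HB.instance Definition _ := isSuperalgebra.Build (tpow d A)
  tring_hcomp1 tring_hcompM.

Lemma tact_mul g (s t : tpow d A) : tact g (s * t) = tact g s * tact g t.
Proof. exact: (tact_tmul mul_biadd). Qed.

End TensorAlgebra.

Section MatrixSuper.
Variables (A : superspaceType) (m n : nat).

Definition mx_hcomp (b : bool) (X : 'M[A]_(m, n)) : 'M[A]_(m, n) :=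
  map_mx (hcomp b) X.

Fact mx_hcomp_zm b : zmod_morphism (mx_hcomp b).
Proof. by move=> X Y; apply/matrixP => i j; rewrite !mxE raddfB. Qed.
Fact mx_hcompK b c X :
  mx_hcomp b (mx_hcomp c X) = if b == c then mx_hcomp c X else 0.
Proof.
by apply/matrixP => i j; rewrite !mxE hcompK; case: (b == c); rewrite !mxE.
Qed.
Fact mx_hcomp_split X : X = mx_hcomp false X + mx_hcomp true X.
Proof. by apply/matrixP => i j; rewrite !mxE -hcomp_split. Qed.

HB.instance Definition _ := isSuperspace.Build 'M[A]_(m, n)
  mx_hcomp_zm mx_hcompK mx_hcomp_split.

Lemma mx_hcompP b (X : 'M[A]_(m, n)) :
  hcomp b X = X <-> forall i j, hcomp b (X i j) = X i j.
Proof.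
split=> [/matrixP h i j|h]; first by have := h i j; rewrite mxE.
by apply/matrixP => i j; rewrite mxE.
Qed.
End MatrixSuper.

Section MatrixSuperalg.
Variable A : superalgType.

Lemma mulmx_biadd m n p :
  evenbiadd (@mulmx A m n p : 'M[A]_(m, n) -> 'M[A]_(n, p) -> 'M[A]_(m, p)).
Proof.
split=> [Y X X'|X Y Y'|b c X Y]; first exact: mulmxBl.
  exact: mulmxBr.
move=> /mx_hcompP hX /mx_hcompP hY; apply/mx_hcompP => i k.
rewrite !mxE raddf_sum /=; apply: eq_bigr => j _.
exact: hcomp_mul.
Qed.

Variable n : nat.

Fact mx_hcomp1 : hcomp false (1 : 'M[A]_n) = 1.
Proof.
apply/mx_hcompP => i j; rewrite !mxE.
by case: (i == j); rewrite /= ?hcomp_one ?raddf0.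
Qed.
Fact mx_hcompM b c (X Y : 'M[A]_n) : hcomp b X = X -> hcomp c Y = Y ->
  hcomp (b (+) c) (X * Y) = X * Y.
Proof. by case: (mulmx_biadd n n n) => _ _; apply. Qed.

HB.instance Definition _ := isSuperalgebra.Build 'M[A]_n mx_hcomp1 mx_hcompM.

End MatrixSuperalg.

Section Wreath.
Variables (d : nat) (A : superalgType).

(* The element \sum_g x_g (x) g is the family g |-> x_g.  The product of S_d is
   composition of maps, g h = g \o h, whereas in {perm T} one has
   (h * g)%g = g \o h; hence the order of factors below. *)
Definition wreath : Type := {ffun 'S_d -> tpow d A}.
HB.instance Definition _ := GRing.Zmodule.copy wreath {ffun 'S_d -> tpow d A}.
Implicit Types w y z : wreath.

Definition wmk (x : tpow d A) (g : 'S_d) : wreath :=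
  [ffun h => if h == g then x else 0].

Definition wone : wreath := wmk 1 1%g.

(* (x (x) g) (y (x) h) = x y^(g^-1) (x) g h, as g y = y^(g^-1) g *)
Definition wmul w z : wreath :=
  [ffun k => \sum_(g : 'S_d) w g * tact (g^-1)%g (z (k * g^-1)%g)].

Definition whcomp b w : wreath := [ffun g => hcomp b (w g)].

Fact wmulA : associative wmul.
Proof.
move=> w z y; apply/ffunP => k; rewrite !ffunE.
transitivity (\sum_g \sum_l w g * (tact (g^-1)%g (z l) *
    tact ((l * g)^-1)%g (y (k * (l * g)^-1)%g))).
  apply: eq_bigr => g _; rewrite ffunE (zm_sum _ _ _ (tact_zm _)) mulr_sumr.
  apply: eq_bigr => l _; rewrite tact_mul tactM invMg mulgA.
  by congr (_ * (_ * _)).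
under [RHS]eq_bigr => h _ do rewrite ffunE mulr_suml.
rewrite [RHS]exchange_big /=; apply: eq_bigr => g _.
rewrite [RHS](reindex_inj (mulIg g)); apply: eq_bigr => l _ /=.
by rewrite mulgK mulrA.
Qed.

Fact wmul1l : left_id wone wmul.
Proof.
move=> w; apply/ffunP => k; rewrite ffunE (bigD1 1%g) //= !ffunE eqxx.
rewrite mul1r invg1 mulg1 tact1 big1 ?addr0 // => g g1.
by rewrite ffunE (negPf g1) mul0r.
Qed.

Fact wmul1r : right_id wone wmul.
Proof.
move=> w; apply/ffunP => k; rewrite ffunE (bigD1 k) //= !ffunE mulgV eqxx.
rewrite tact_one mulr1 big1 ?addr0 // => g gk.
rewrite ffunE -eq_mulgV1 eq_sym (negPf gk).
by rewrite (zm0 (tact_zm _)) mulr0.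
Qed.

Fact wmulDl : left_distributive wmul +%R.
Proof.
move=> w z y; apply/ffunP => k; rewrite !ffunE -big_split.
by apply: eq_bigr => g _; rewrite ffunE mulrDl.
Qed.

Fact wmulDr : right_distributive wmul +%R.
Proof.
move=> w z y; apply/ffunP => k; rewrite !ffunE -big_split.
by apply: eq_bigr => g _; rewrite ffunE (zmD _ _ (tact_zm _)) mulrDr.
Qed.

HB.instance Definition _ := GRing.Zmodule_isPzRing.Build wreath
  wmulA wmul1l wmul1r wmulDl wmulDr.

Fact whcomp_zm b : zmod_morphism (whcomp b).
Proof. by move=> w z; apply/ffunP => g; rewrite !ffunE raddfB. Qed.
Fact whcompK b c w :
  whcomp b (whcomp c w) = if b == c then whcomp c w else 0.
Proof.
by apply/ffunP => g; rewrite !ffunE hcompK; case: (b == c); rewrite !ffunE.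
Qed.
Fact whcomp_split w : w = whcomp false w + whcomp true w.
Proof. by apply/ffunP => g; rewrite !ffunE -hcomp_split. Qed.

HB.instance Definition _ := isSuperspace.Build wreath
  whcomp_zm whcompK whcomp_split.

Lemma whcompP b w : hcomp b w = w <-> forall g, hcomp b (w g) = w g.
Proof.
split=> [/ffunP h g|h]; first by have := h g; rewrite ffunE.
by apply/ffunP => g; rewrite ffunE.
Qed.

Fact whcomp1 : hcomp false (1 : wreath) = 1.
Proof.
apply/whcompP => g; rewrite ffunE.
by case: (g == 1%g); rewrite ?hcomp_one ?raddf0.
Qed.
Fact whcompM b c (w z : wreath) : hcomp b w = w -> hcomp c z = z ->
  hcomp (b (+) c) (w * z) = w * z.
Proof.
move=> /whcompP hw /whcompP hz; apply/whcompP => k; rewrite ffunE raddf_sum.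
by apply: eq_bigr => g _; apply: hcomp_mul; rewrite ?tact_hcomp ?hz.
Qed.

HB.instance Definition _ := isSuperalgebra.Build wreath whcomp1 whcompM.

Lemma wmkM (x x' : tpow d A) g h :
  wmk x g * wmk x' h = wmk (x * tact (g^-1)%g x') (h * g)%g.
Proof.
apply/ffunP => k; rewrite !ffunE (bigD1 g) //= !ffunE eqxx big1 => [|l lg].
  rewrite addr0 -(inj_eq (mulIg g)) mulgKV.
  by case: eqP => // _; rewrite (zm0 (tact_zm _)) mulr0.
by rewrite ffunE (negPf lg) mul0r.
Qed.

Lemma wmk_conj x g : wmk 1 (g^-1)%g * wmk x 1%g * wmk 1 g = wmk (tact g x) 1%g.
Proof. by rewrite !wmkM invgK mul1r tact_one mulr1 mul1g mulgV. Qed.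

End Wreath.

Section Actions.
Variables (A : superalgType) (n d : nat).
Local Notation tV := (tpow d 'cV[A]_n).

Definition colmulr (v : 'cV[A]_n) (a : A) : 'cV[A]_n := \col_i (v i 0 * a).

Definition lact (s : tpow d 'M[A]_n) (v : tV) : tV :=
  tmul (fun (X : 'M[A]_n) (v : 'cV[A]_n) => X *m v) s v.

Definition tract (v : tV) (a : tpow d A) : tV := tmul colmulr v a.

Definition wact (v : tV) (w : wreath d A) : tV :=
  \sum_(g : 'S_d) tact g (tract v (w g)).

Lemma colmulr_biadd : evenbiadd colmulr.
Proof.
split=> [y x x'|x y y'|b c x y /mx_hcompP hx hy].
- by apply/matrixP => i j; rewrite !mxE mulrBl.
- by apply/matrixP => i j; rewrite !mxE mulrBr.
- by apply/mx_hcompP => i j; rewrite !mxE; apply: hcomp_mul.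
Qed.

Lemma lact1 v : lact 1 v = v.
Proof.
move: v; apply: tpow_eq => // [|u x xu].
  exact: (tmul_zmr (mulmx_biadd A n n 1)).
rewrite /lact (tmulE (mulmx_biadd A n n 1) (hpart_one _ 'M[A]_n) xu) sgn20l.
by congr tens; apply/ffunP => i; rewrite !ffunE mul1mx.
Qed.

Lemma lactM s t v : lact (s * t) v = lact s (lact t v).
Proof.
apply: tmulA; try exact: mulmx_biadd.
by move=> x y z; rewrite -mulmxA.
Qed.

Lemma tractA v a b : tract (tract v a) b = tract v (a * b).
Proof.
apply: tmulA; try exact: colmulr_biadd; first exact: mul_biadd.
by move=> x y z; apply/matrixP => i j; rewrite !mxE mulrA.
Qed.

Lemma lact_tract s v a : tract (lact s v) a = lact s (tract v a).
Proof.
apply: tmulA; try exact: colmulr_biadd; try exact: mulmx_biadd.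
move=> x y z; apply/matrixP => i j; rewrite !mxE mulr_suml.
by apply: eq_bigr => k _; rewrite !mxE mulrA.
Qed.

Lemma tact_lact g s v : tact g (lact s v) = lact (tact g s) (tact g v).
Proof. exact: (tact_tmul (mulmx_biadd A n n 1)). Qed.

Lemma tact_tract g v a : tact g (tract v a) = tract (tact g v) (tact g a).
Proof. exact: (tact_tmul colmulr_biadd). Qed.

Lemma wact_zml w : zmod_morphism (wact^~ w).
Proof.
move=> x y; rewrite /wact -sumrB; apply: eq_bigr => g _.
by rewrite -tact_zm [tract (_ - _) _](tmul_zml colmulr_biadd).
Qed.

Lemma wact_zmr v : zmod_morphism (wact v).
Proof.
move=> x y; rewrite /wact -sumrB; apply: eq_bigr => g _.
by rewrite -tact_zm !ffunE [tract _ (_ - _)](tmul_zmr colmulr_biadd).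
Qed.

Lemma wact_biadd : evenbiadd wact.
Proof.
split=> [||b c v w hv /whcompP hw]; [exact: wact_zml | exact: wact_zmr |].
rewrite /wact raddf_sum; apply: eq_bigr => g _ /=; rewrite tact_hcomp.
by congr tact; apply: (tmul_even colmulr_biadd).
Qed.

Lemma wact1 v : wact v 1 = v.
Proof.
rewrite /wact (bigD1 1%g) //= ffunE eqxx tact1 big1 ?addr0.
  apply: (tone_r colmulr_biadd) => x.
  by apply/matrixP => i j; rewrite mxE mulr1 ord1.
move=> g g1; rewrite ffunE (negPf g1).
by rewrite [tract _ _](zm0 (tmul_zmr colmulr_biadd v)) (zm0 (tact_zm g)).
Qed.

Lemma wactA v w z : wact (wact v w) z = wact v (w * z).
Proof.
rewrite /wact.
transitivity (\sum_h \sum_g tact (h * g)%g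
    (tract v (w g * tact (g^-1)%g (z h)))).
  apply: eq_bigr => h _.
  rewrite [tract _ _](zm_sum _ _ _ (tmul_zml colmulr_biadd _)).
  rewrite (zm_sum _ _ _ (tact_zm _)); apply: eq_bigr => g _.
  rewrite -tractA -tactM [tact g (tract (tract _ _) _)]tact_tract.
  by rewrite [tact g (tact _ (z h))]tactM mulgV tact1.
under [RHS]eq_bigr => k _.
  rewrite ffunE [tract _ _](zm_sum _ _ _ (tmul_zmr colmulr_biadd _)).
  rewrite (zm_sum _ _ _ (tact_zm _)); over.
rewrite exchange_big [RHS]exchange_big /=; apply: eq_bigr => g _.
by rewrite [RHS](reindex_inj (mulIg g)); apply: eq_bigr => h _; rewrite mulgK.
Qed.

End Actions.

Section Schur.
Variables (A : superalgType) (n d : nat).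

Definition schur_pred : {pred tpow d 'M[A]_n} :=
  fun t => [forall g : 'S_d, tact g t == t].

Lemma schurP t : reflect (forall g, tact g t = t) (t \in schur_pred).
Proof. exact: 'forall_eqP. Qed.

Fact schur_subring : subring_closed schur_pred.
Proof.
split=> [|s t /schurP hs /schurP ht|s t /schurP hs /schurP ht];
  apply/schurP => g.
- exact: tact_one.
- by rewrite tact_zm hs ht.
- by rewrite tact_mul hs ht.
Qed.

Definition schur : Type := {t : tpow d 'M[A]_n | t \in schur_pred}.
HB.instance Definition _ := [isSub of schur for sval].
HB.instance Definition _ := [Choice of schur by <:].
HB.instance Definition _ := GRing.SubChoice_isSubPzRing.Build (tpow d 'M[A]_n)
  schur_pred schur schur_subring.

Fact schur_hcomp_subproof b (s : schur) : hcomp b (val s) \in schur_pred.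
Proof.
by apply/schurP => g; rewrite -tact_hcomp (schurP _ (valP s)).
Qed.
Definition schur_hcomp b (s : schur) : schur :=
  Sub (hcomp b (val s)) (schur_hcomp_subproof b s).

Fact schur_hcomp_zm b : zmod_morphism (schur_hcomp b).
Proof. by move=> s t; apply: val_inj; rewrite /= !raddfB. Qed.
Fact schur_hcompK b c s :
  schur_hcomp b (schur_hcomp c s) = if b == c then schur_hcomp c s else 0.
Proof.
by apply: val_inj; rewrite /= hcompK; case: (b == c); rewrite ?raddf0.
Qed.
Fact schur_hcomp_split s : s = schur_hcomp false s + schur_hcomp true s.
Proof. by apply: val_inj; rewrite raddfD /= -hcomp_split. Qed.

HB.instance Definition _ := isSuperspace.Build schur
  schur_hcomp_zm schur_hcompK schur_hcomp_split.

Fact schur_hcomp1 : hcomp false (1 : schur) = 1.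
Proof. by apply: val_inj; rewrite /= hcomp_one. Qed.
Fact schur_hcompM b c (s t : schur) : hcomp b s = s -> hcomp c t = t ->
  hcomp (b (+) c) (s * t) = s * t.
Proof.
move=> /(congr1 val) hs /(congr1 val) ht; apply: val_inj.
by rewrite rmorphM; apply: hcomp_mul.
Qed.
HB.instance Definition _ := isSuperalgebra.Build schur schur_hcomp1 schur_hcompM.

Definition sact (s : schur) (v : tpow d 'cV[A]_n) : tpow d 'cV[A]_n :=
  lact (val s) v.

End Schur.

Section Endomorphisms.
Variables (A : superalgType) (n d : nat).
Local Notation tV := (tpow d 'cV[A]_n).

(* Endomorphisms of the right module V^{(x)d} over the super wreath product, not
   only the even ones; they act from the left. *)
Record endW := EndW {
  endW_fun :> tV -> tV;
  endW_zmod : zmod_morphism endW_fun;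
  endW_lin : forall v w, endW_fun (wact v w) = wact (endW_fun v) w
}.

HB.instance Definition _ := gen_eqMixin endW.
HB.instance Definition _ := gen_choiceMixin endW.

Lemma endW_eq (f g : endW) : (forall v, f v = g v) -> f = g.
Proof.
case: f g => [f fD fL] [g gD gL] /= /funext fg; move: fD fL gD gL.
by rewrite fg => *; congr EndW; apply: Prop_irrelevance.
Qed.

Fact endW0_zmod : zmod_morphism (fun _ : tV => 0 : tV).
Proof. by move=> x y; rewrite subr0. Qed.
Fact endW0_lin (v : tV) w : 0 = wact (0 : tV) w.
Proof. by rewrite (zm0 (wact_zml w)). Qed.
Definition endW0 := EndW endW0_zmod endW0_lin.

Fact endWN_zmod (f : endW) : zmod_morphism (fun v => - f v).
Proof. by move=> x y; rewrite (endW_zmod f) opprD. Qed.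
Fact endWN_lin (f : endW) v w : - f (wact v w) = wact (- f v) w.
Proof. by rewrite endW_lin (zmN _ (wact_zml w)). Qed.
Definition endWN f := EndW (endWN_zmod f) (endWN_lin f).

Fact endWD_zmod (f g : endW) : zmod_morphism (fun v => f v + g v).
Proof. by move=> x y; rewrite (endW_zmod f) (endW_zmod g) opprD addrACA. Qed.
Fact endWD_lin (f g : endW) v w :
  f (wact v w) + g (wact v w) = wact (f v + g v) w.
Proof. by rewrite !endW_lin (zmD _ _ (wact_zml w)). Qed.
Definition endWD f g := EndW (endWD_zmod f g) (endWD_lin f g).

Fact endWDA : associative endWD.
Proof. by move=> f g h; apply: endW_eq => v /=; rewrite addrA. Qed.
Fact endWDC : commutative endWD.
Proof. by move=> f g; apply: endW_eq => v /=; rewrite addrC. Qed.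
Fact endWD0 : left_id endW0 endWD.
Proof. by move=> f; apply: endW_eq => v /=; rewrite add0r. Qed.
Fact endWDN : left_inverse endW0 endWN endWD.
Proof. by move=> f; apply: endW_eq => v /=; rewrite addNr. Qed.

HB.instance Definition _ := GRing.isZmodule.Build endW endWDA endWDC endWD0 endWDN.

Fact endW1_zmod : zmod_morphism (fun v : tV => v).
Proof. by []. Qed.
Definition endW1 := EndW endW1_zmod (fun v w => erefl).

Fact endWM_zmod (f g : endW) : zmod_morphism (fun v => f (g v)).
Proof. by move=> x y; rewrite (endW_zmod g) (endW_zmod f). Qed.
Fact endWM_lin (f g : endW) v w : f (g (wact v w)) = wact (f (g v)) w.
Proof. by rewrite !endW_lin. Qed.
Definition endWM f g := EndW (endWM_zmod f g) (endWM_lin f g).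

Fact endWMA : associative endWM.
Proof. by move=> f g h; apply: endW_eq. Qed.
Fact endWM1l : left_id endW1 endWM.
Proof. by move=> f; apply: endW_eq. Qed.
Fact endWM1r : right_id endW1 endWM.
Proof. by move=> f; apply: endW_eq. Qed.
Fact endWMDl : left_distributive endWM +%R.
Proof. by move=> f g h; apply: endW_eq. Qed.
Fact endWMDr : right_distributive endWM +%R.
Proof. by move=> f g h; apply: endW_eq => v; apply: (zmD _ _ (endW_zmod f)). Qed.

HB.instance Definition _ := GRing.Zmodule_isPzRing.Build endW
  endWMA endWM1l endWM1r endWMDl endWMDr.

Lemma hcomp_wact e (v : tV) c (w : wreath d A) : hcomp c w = w ->
  hcomp e (wact v w) = wact (hcomp (e (+) c) v) w.
Proof.
case: (wact_biadd A n d) => wl _ wE hw.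
rewrite {1}(hcomp_split v) (zmD _ _ (wl w)) raddfD /=.
rewrite !(hcomp_eq _ (wE _ c _ w (hcomp_id _ v) hw)).
by case: e; case: c {hw}; rewrite /= ?addr0 ?add0r.
Qed.

(* A homogeneous endomorphism of parity b shifts parities by b. *)
Fact endWh_zmod b (f : endW) :
  zmod_morphism (fun v => \sum_(c : bool) hcomp (b (+) c) (f (hcomp c v))).
Proof.
move=> x y; rewrite -sumrB; apply: eq_bigr => c _.
by rewrite raddfB (endW_zmod f) raddfB.
Qed.
Fact endWh_lin b (f : endW) v w :
  \sum_(c : bool) hcomp (b (+) c) (f (hcomp c (wact v w))) =
  wact (\sum_(c : bool) hcomp (b (+) c) (f (hcomp c v))) w.
Proof.
case: (wact_biadd A n d) => wl wr _.
pose F v := \sum_(c : bool) hcomp (b (+) c) (f (hcomp c v)).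
suff H e : F (wact v (hcomp e w)) = wact (F v) (hcomp e w).
  change (F (wact v w) = wact (F v) w); rewrite (hcomp_split w).
  have FD x y : F (x + y) = F x + F y := zmD x y (endWh_zmod b f).
  by rewrite !(zmD _ _ (wr _)) FD !H.
have he := hcomp_id e w; move: (hcomp e w) he => {}w hw.
rewrite /F (zm_sum _ _ _ (wl w)) (reindex_inj (h := fun c => c (+) e)); last first.
  by move=> c c' /addIb.
apply: eq_bigr => c _; rewrite (hcomp_wact _ _ hw) endW_lin (hcomp_wact _ _ hw).
by rewrite -!addbA addbb !addbF.
Qed.
Definition endW_hcomp b f := EndW (endWh_zmod b f) (endWh_lin b f).

Fact endWh_zm b : zmod_morphism (endW_hcomp b).
Proof.
move=> f g; apply: endW_eq => v /=; rewrite -[RHS]sumrB.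
by apply: eq_bigr => c _; rewrite -raddfB.
Qed.
Fact endWhK b c f :
  endW_hcomp b (endW_hcomp c f) = if b == c then endW_hcomp c f else 0.
Proof.
apply: endW_eq => v; transitivity (\sum_(e : bool)
    hcomp (b (+) e) (hcomp (c (+) e) (f (hcomp e v)))).
  apply: eq_bigr => e _ /=; congr hcomp.
  rewrite (bigD1 e) //= hcomp_id big1 ?addr0 // => e' ee'.
  by rewrite hcompK (negPf ee') (zm0 (endW_zmod f)) raddf0.
case: eqP => [->|/eqP bc].
  by apply: eq_bigr => e _; rewrite hcomp_id.
rewrite big1 // => e _; rewrite hcompK.
have -> // : (b (+) e == c (+) e) = false.
by move: bc; case: b; case: c; case: e.
Qed.
Fact endWh_split f : f = endW_hcomp false f + endW_hcomp true f.
Proof.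
apply: endW_eq => v; rewrite {1}(hcomp_split v) (zmD _ _ (endW_zmod f)).
rewrite {1}(hcomp_split (f (hcomp false v))) {1}(hcomp_split (f (hcomp true v))).
change ((endW_hcomp false f + endW_hcomp true f) v) with
  (endW_hcomp false f v + endW_hcomp true f v).
rewrite /= !big_bool /= [X in _ + X = _]addrC addrACA.
by congr (_ + _); exact: addrC.
Qed.

HB.instance Definition _ := isSuperspace.Build endW endWh_zm endWhK endWh_split.

Lemma endWhP b (f : endW) : hcomp b f = f <->
  forall c v, hcomp c v = v -> hcomp (b (+) c) (f v) = f v.
Proof.
split=> [fh c v hv|h].
  rewrite -{2}fh /= (bigD1 c) //= hv big1 ?addr0 // => e ec.
  by rewrite (hcomp_neq hv ec) (zm0 (endW_zmod f)) raddf0.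
apply: endW_eq => v /=; rewrite [in RHS](hcomp_sum v).
rewrite (zm_sum _ _ _ (endW_zmod f)); apply: eq_bigr => c _.
exact/h/hcomp_id.
Qed.

Fact endWh1 : hcomp false (1 : endW) = 1.
Proof. by apply/endWhP => c v. Qed.
Fact endWhM b c (f g : endW) : hcomp b f = f -> hcomp c g = g ->
  hcomp (b (+) c) (f * g) = f * g.
Proof.
move=> /endWhP hf /endWhP hg; apply/endWhP => e v hv.
by rewrite -addbA; apply/hf/hg.
Qed.
HB.instance Definition _ := isSuperalgebra.Build endW endWh1 endWhM.

End Endomorphisms.

(* Main.v *)
Require Import Defs.
From HB Require Import structures.
From mathcomp Require Import all_boot all_order all_fingroup all_algebra.

(** The endomorphisms of a free module of finite rank over a ring are the
    matrices over that ring, and the theorem is this fact for V^{(x)d} over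
    A^{(x)d}, followed by taking invariants under the symmetric group.

    Write e_i for the standard basis of V and e_I for the tensor of the e_(I k),
    where I runs over the maps from 'I_d to 'I_n.  Since tensor powers distribute
    over finite direct sums, V^{(x)d} is the direct sum of the e_I A^{(x)d}
    ([vbasis_coord]), and M_n(A)^{(x)d} is the direct sum of copies of A^{(x)d},
    one for each matrix position (I, J) ([munit_coord]).  The e_I are even, so no
    sign appears when an element xi of M_n(A)^{(x)d} is applied to e_J: the
    coordinate of xi e_J at I is the entry of xi at (I, J) ([vcoord_lact]).

    Hence xi is determined by its action ([lact_faithful]), and each endomorphism
    f commuting with A^{(x)d} is the action of the xi with entries the coordinates
    of the f e_J ([tlinear_lact]).  If f moreover commutes with the symmetric
    group, then xi^g acts as v |-> (f (v^(g^-1)))^g = f v, that is as xi does, so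
    that xi^g = xi by faithfulness and xi lies in S^A(n, d)
    ([schur_endW_surj]). *)

Set Implicit Arguments.
Unset Strict Implicit.
Unset Printing Implicit Defensive.

Import GRing.Theory.
Local Open Scope ring_scope.

(** * Tensor powers of additive maps *)

Section TensorMap.
Variables (d : nat) (M N : zmodType).

(** The tensor product of the maps [phi k]. There are no signs in it because all
    the maps it is used for preserve parity. *)
Definition tmap (phi : 'I_d -> M -> N) : tpow d M -> tpow d N :=
  tlift (fun x => tens [ffun k => phi k (x k)]).

Lemma eq_tmap phi psi : (forall k, phi k =1 psi k) -> tmap phi =1 tmap psi.
Proof.
by move=> h t; congr (tmap _ t); apply: boolp.funext => k; apply: boolp.funext.
Qed.

Variable phi : 'I_d -> M -> N.
Hypothesis phi_zm : forall k, zmod_morphism (phi k).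

Lemma tmap_multiadd :
  multiadd (fun x : {ffun 'I_d -> M} => tens [ffun k => phi k (x k)]).
Proof.
move=> x i a b.
have E c : [ffun k => phi k (upd x i c k)] =
    upd [ffun k => phi k (x k)] i (phi i c).
  by apply/ffunP => k; rewrite !ffunE; case: eqP => [->|].
by rewrite !E (zmD _ _ (phi_zm i)) tens_multiadd.
Qed.

Lemma tmap_zm : zmod_morphism (tmap phi).
Proof. exact/tlift_zmod/tmap_multiadd. Qed.

Lemma tmapE (x : {ffun 'I_d -> M}) :
  tmap phi (tens x) = tens [ffun k => phi k (x k)].
Proof. exact/tlift_tens/tmap_multiadd. Qed.

End TensorMap.

Lemma tens_eq0 (d : nat) (M : zmodType) (x : {ffun 'I_d -> M}) i :
  x i = 0 -> tens x = 0.
Proof. exact/multiadd0/tens_multiadd. Qed.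

(** * Tensor powers of direct sums *)

Lemma ffun_neqP (D : finType) (T : eqType) (f g : {ffun D -> T}) :
  f != g -> exists k, f k != g k.
Proof.
move=> fg; apply/existsP; rewrite -negb_forall.
by apply: contraNN fg => /forallP h; apply/eqP/ffunP => k; apply/eqP.
Qed.

(** The maps [inj j] and [prj j] present [M] as a direct sum of copies of [A]
    indexed by [J]. *)
Section Coordinates.
Variables (d : nat) (M A : zmodType) (J : finType).
Variables (inj : J -> A -> M) (prj : J -> M -> A).
Hypothesis inj_zm : forall j, zmod_morphism (inj j).
Hypothesis prj_zm : forall j, zmod_morphism (prj j).
Hypothesis prj_inj : forall j k a, prj j (inj k a) = if j == k then a else 0.
Hypothesis sum_inj_prj : forall m, m = \sum_j inj j (prj j m).

(** Expanding the factors of a pure tensor one at a time into their components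
    reduces it to tensors whose factors each lie in a single summand. *)
Lemma tpow_coord_ind (P : tpow d M -> Prop) :
  P 0 -> (forall s t, P s -> P t -> P (s - t)) ->
  (forall (c : {ffun 'I_d -> J}) (a : {ffun 'I_d -> A}),
     P (tens [ffun k => inj (c k) (a k)])) ->
  forall t, P t.
Proof.
move=> P0 PB Pc; apply: tpow_ind => // x.
have PD s t : P s -> P t -> P (s + t).
  move=> hs ht; rewrite -[t]opprK; apply: (PB) => //.
  by rewrite -sub0r; apply: PB.
(* s lists the factors that are still to be expanded. *)
suff H (s : seq 'I_d) : forall x : {ffun 'I_d -> M},
    (forall i, i \notin s -> exists j, inj j (prj j (x i)) = x i) -> P (tens x).
  by apply: (H (enum 'I_d)) => i; rewrite mem_enum.
elim: s => [|i s IHs] {}x hx.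
  have /fin_all_exists [c cx] i := hx i isT.
  rewrite (_ : x = [ffun k => inj (([ffun i => c i] : {ffun _}) k)
     (([ffun i => prj (c i) (x i)] : {ffun _}) k)]) //.
  by apply/ffunP => k; rewrite !ffunE cx.
have updD : zmod_morphism (fun m => tens (upd x i m)).
  move=> a b; have h := tens_multiadd x i.
  by apply/eqP; rewrite eq_sym subr_eq -h subrK.
rewrite -(upd_id x i) (sum_inj_prj (x i)) (zm_sum _ _ _ updD).
apply: big_ind => // j _; apply: IHs => k ks; rewrite ffunE.
have [_|ki] := eqVneq k i; first by exists j; rewrite prj_inj eqxx.
by apply: hx; rewrite inE negb_or ki.
Qed.

(** Both sides are additive in [t], so [t] may be taken to be a tensor with each
    factor in a single summand; all terms but one then vanish by orthogonality,
    as each of them has a zero factor. *)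
Lemma tpow_coord (t : tpow d M) :
  t = \sum_(c : {ffun 'I_d -> J})
        tmap (fun k => inj (c k)) (tmap (fun k => prj (c k)) t).
Proof.
have izm (c : {ffun 'I_d -> J}) k : zmod_morphism (inj (c k)) by [].
have pzm (c : {ffun 'I_d -> J}) k : zmod_morphism (prj (c k)) by [].
move: t; apply: tpow_coord_ind => [|s t {1}-> {1}->|c a].
- rewrite big1 // => c _.
  by rewrite (zm0 (tmap_zm (pzm c))) (zm0 (tmap_zm (izm c))).
- rewrite -sumrB; apply: eq_bigr => c _.
  by rewrite (tmap_zm (pzm c)) (tmap_zm (izm c)).
rewrite (bigD1 c) //= big1 ?addr0 => [|e ec].
  rewrite (tmapE (pzm c)) (tmapE (izm c)); congr tens.
  by apply/ffunP => k; rewrite !ffunE prj_inj eqxx.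
have [k ek] := ffun_neqP ec.
rewrite (tmapE (pzm e)) (@tens_eq0 _ _ _ k) ?(zm0 (tmap_zm (izm e))) //.
by rewrite !ffunE prj_inj (negPf ek).
Qed.

End Coordinates.

(** * Matrices as endomorphisms of the free module V^{(x)d} *)

Section MatrixAction.
Variables (A : superalgType) (n d : nat).
Implicit Types (I J : {ffun 'I_d -> 'I_n}) (v : tpow d 'cV[A]_n).
Implicit Types (s : tpow d 'M[A]_n).

Definition vbasis I : tpow d 'cV[A]_n := tens [ffun k => delta_mx (I k) 0].

Definition vcoord I : tpow d 'cV[A]_n -> tpow d A :=
  tmap (fun k (x : 'cV[A]_n) => x (I k) 0).

Definition munit I J : tpow d A -> tpow d 'M[A]_n :=
  tmap (fun k a => a *: delta_mx (I k) (J k)).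

Definition mcoord I J : tpow d 'M[A]_n -> tpow d A :=
  tmap (fun k (X : 'M[A]_n) => X (I k) (J k)).

Lemma entry_zm m p (i : 'I_m) (j : 'I_p) :
  zmod_morphism (fun X : 'M[A]_(m, p) => X i j).
Proof. by move=> X Y; rewrite !mxE. Qed.

Lemma munit_zm I J : zmod_morphism (munit I J).
Proof. by apply: tmap_zm => k a b; rewrite scalerBl. Qed.

Lemma hpart_vbasis I : hpart [ffun=> false] [ffun k => delta_mx (I k) 0] =
  [ffun k => delta_mx (I k) 0] :> {ffun 'I_d -> 'cV[A]_n}.
Proof.
apply/ffunP => k; rewrite !ffunE; apply/mx_hcompP => i j; rewrite !mxE.
by case: (_ && _); rewrite ?hcomp_one ?raddf0.
Qed.

Lemma tract_vbasis I (a : tpow d A) :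
  tract (vbasis I) a = tmap (fun k b => colmulr (delta_mx (I k) 0) b) a.
Proof.
have zm k : zmod_morphism (fun b : A => colmulr (delta_mx (I k) 0) b).
  by case: (colmulr_biadd A n).
move: a; apply: tpow_eq.
- exact: (tmul_zmr (colmulr_biadd A n)).
- exact: tmap_zm.
move=> u x xu; rewrite (tmapE zm) /tract.
rewrite (tmulE (colmulr_biadd A n) (hpart_vbasis I) xu) sgn20l.
by congr tens; apply/ffunP => k; rewrite !ffunE.
Qed.

(** V is the direct sum of the e_i A, so V^{(x)d} is that of the e_I A^{(x)d}. *)
Lemma vbasis_coord v : v = \sum_I tract (vbasis I) (vcoord I v).
Proof.
rewrite [LHS](@tpow_coord d _ A _ (fun (i : 'I_n) a => colmulr (delta_mx i 0) a)
  (fun (i : 'I_n) (x : 'cV[A]_n) => x i 0)).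
- by apply: eq_bigr => I _; rewrite tract_vbasis.
- by move=> i; case: (colmulr_biadd A n).
- by move=> i; apply: entry_zm.
- by move=> i k a; rewrite !mxE eqxx andbT; case: eqP; rewrite ?mul1r ?mul0r.
move=> x; apply/matrixP => i j; rewrite ord1 summxE.
rewrite (bigD1 i) //= big1 => [|k ki].
  by rewrite !mxE !eqxx mul1r addr0.
by rewrite !mxE eq_sym (negPf ki) mul0r.
Qed.

(** The same decomposition for M_n(A), the direct sum of its positions (i, j); a
    family of positions is a pair of families of indices. *)
Lemma munit_coord s : s = \sum_I \sum_J munit I J (mcoord I J s).
Proof.
rewrite pair_bigA [LHS](@tpow_coord d _ A _
  (fun (p : 'I_n * 'I_n) a => a *: delta_mx p.1 p.2)
  (fun (p : 'I_n * 'I_n) (X : 'M[A]_n) => X p.1 p.2)).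
- pose h (c : {ffun 'I_d -> 'I_n * 'I_n}) :=
    ([ffun k => (c k).1], [ffun k => (c k).2]).
  pose h' (p : {ffun 'I_d -> 'I_n} * {ffun 'I_d -> 'I_n}) :=
    [ffun k => (p.1 k, p.2 k)].
  rewrite [RHS](reindex h) /=; last first.
    exists h' => [c|[I J]] _.
      by apply/ffunP => k; rewrite !ffunE -surjective_pairing.
    by congr pair; apply/ffunP => k; rewrite !ffunE.
  apply: eq_bigr => c _.
  transitivity (munit (h c).1 (h c).2
      (tmap (fun k (X : 'M[A]_n) => X (c k).1 (c k).2) s)).
    by apply: eq_tmap => k a; rewrite !ffunE.
  by congr munit; apply: eq_tmap => k X; rewrite !ffunE.
- by move=> p a b; rewrite scalerBl.
- by move=> p; apply: entry_zm.
- move=> [i j] [k l] a; rewrite !mxE xpair_eqE.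
  by case: (_ && _); rewrite ?mulr1 ?mulr0.
move=> X; apply/matrixP => i j; rewrite summxE.
rewrite (bigD1 (i, j)) //= big1 => [|[k l] kl].
  by rewrite !mxE !eqxx mulr1 addr0.
rewrite !mxE /=; have -> : (i == k) && (j == l) = false; last by rewrite mulr0.
by rewrite -xpair_eqE eq_sym (negPf kl).
Qed.

(** The J-th column of a matrix is its value on the J-th basis vector; the sign
    is trivial because the basis vectors are even. *)
Lemma vcoord_lact I J s : vcoord I (lact s (vbasis J)) = mcoord I J s.
Proof.
have vzm k : zmod_morphism (fun x : 'cV[A]_n => x (I k) 0).
  exact: entry_zm.
have mzm k : zmod_morphism (fun X : 'M[A]_n => X (I k) (J k)).
  exact: entry_zm.
move: s; apply: tpow_eq.
- apply: (zm_comp (tmap_zm vzm)); exact: (tmul_zml (mulmx_biadd A n n 1)).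
- exact: tmap_zm.
move=> u X Xu; rewrite /lact (tmulE (mulmx_biadd A n n 1) Xu (hpart_vbasis J)).
rewrite sgn20r expr0 mulr1z /vcoord (tmapE vzm) /mcoord (tmapE mzm).
by congr tens; apply/ffunP => k; rewrite !ffunE -colE mxE.
Qed.

Lemma lact_munit I J K (a : tpow d A) :
  lact (munit I J a) (vbasis K) = if J == K then tract (vbasis I) a else 0.
Proof.
have zm k : zmod_morphism (fun b : A => b *: delta_mx (I k) (J k) : 'M[A]_n).
  by move=> b c; rewrite scalerBl.
have lzm t := tmul_zml (mulmx_biadd A n n 1) (d := d) t.
move: a; apply: tpow_eq.
- apply: (zm_comp (lzm _)); exact: munit_zm.
- case: eqP => _; last by move=> x y; rewrite subr0.
  exact: (tmul_zmr (colmulr_biadd A n)).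
move=> u x xu; rewrite /munit (tmapE zm).
have zu : hpart u [ffun k => x k *: delta_mx (I k) (J k)] =
    [ffun k => x k *: delta_mx (I k) (J k)] :> {ffun 'I_d -> 'M[A]_n}.
  apply/ffunP => k; rewrite !ffunE; apply/mx_hcompP => i j; rewrite !mxE.
  have := congr1 (fun y : {ffun _} => y k) xu; rewrite ffunE.
  by case: (_ && _); rewrite ?mulr1 ?mulr0 ?raddf0.
rewrite /lact (tmulE (mulmx_biadd A n n 1) zu (hpart_vbasis K)) sgn20r.
rewrite expr0 mulr1z; case: eqP => [<-|/eqP JK].
  have izm k : zmod_morphism (fun b : A => colmulr (delta_mx (I k) 0) b).
    by case: (colmulr_biadd A n).
  rewrite tract_vbasis (tmapE izm); congr tens; apply/ffunP => k.
  rewrite !ffunE -scalemxAl mul_delta_mx; apply/matrixP => i j.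
  rewrite !mxE ord1 eqxx andbT.
  by case: eqP; rewrite ?mulr1 ?mul1r ?mulr0 ?mul0r.
have [k Jk] := ffun_neqP JK.
apply: (@tens_eq0 _ _ _ k).
by rewrite !ffunE -scalemxAl mul_delta_mx_0 // scaler0.
Qed.

Lemma lact_faithful s t : (forall v, lact s v = lact t v) -> s = t.
Proof.
move=> st; rewrite [s]munit_coord [RHS]munit_coord.
by do 2 (apply: eq_bigr => ? _); rewrite -!vcoord_lact st.
Qed.

(** The matrix of [f] has as columns the coordinates of the values of [f] on the
    basis; it agrees with [f] on the basis, hence everywhere by linearity over
    A^{(x)d}. *)
Lemma tlinear_lact (f : tpow d 'cV[A]_n -> tpow d 'cV[A]_n) :
  zmod_morphism f -> (forall v a, f (tract v a) = tract (f v) a) ->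
  exists s, forall v, f v = lact s v.
Proof.
move=> fD fL; exists (\sum_I \sum_J munit I J (vcoord I (f (vbasis J)))) => v.
set s := \sum_I _; have lzm t := tmul_zml (mulmx_biadd A n n 1) (d := d) t.
have rzm t := tmul_zmr (mulmx_biadd A n n 1) (d := d) t.
have fs K : f (vbasis K) = lact s (vbasis K).
  rewrite [LHS]vbasis_coord [RHS](zm_sum _ _ _ (lzm _)).
  apply: eq_bigr => I _; rewrite (zm_sum _ _ _ (lzm _)).
  rewrite (bigD1 K) //= big1 => [|J JK].
    by rewrite [tmul _ _ _]lact_munit eqxx addr0.
  by rewrite [tmul _ _ _]lact_munit (negPf JK).
rewrite (vbasis_coord v) (zm_sum _ _ _ fD) [RHS](zm_sum _ _ _ (rzm _)).
by apply: eq_bigr => I _; rewrite fL fs lact_tract.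
Qed.

End MatrixAction.

(** * Invariants and endomorphisms over the wreath product *)

Section SchurAction.
Variables (A : superalgType) (n d : nat).
Implicit Types (s t : schur A n d) (v : tpow d 'cV[A]_n) (f : endW A n d).

(** The action of A^{(x)d} commutes with every matrix, and that of the symmetric
    group with the invariant ones, because v^g is compatible with the left
    action of M_n(A)^{(x)d}. *)
Lemma wact_sact s v (w : wreath d A) : wact (sact s v) w = sact s (wact v w).
Proof.
rewrite /wact [RHS](zm_sum _ _ _ (tmul_zmr (mulmx_biadd A n n 1) _)).
apply: eq_bigr => g _; rewrite /sact lact_tract tact_lact.
by rewrite (schurP _ (valP s)).
Qed.

Definition schur_endW s : endW A n d :=
  EndW (tmul_zmr (mulmx_biadd A n n 1) (val s))
    (fun v w => esym (wact_sact s v w)).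

Lemma schur_endW_zm : zmod_morphism schur_endW.
Proof.
by move=> s t; apply: endW_eq => v; apply: (tmul_zml (mulmx_biadd A n n 1)).
Qed.

Lemma schur_endW_monoid : monoid_morphism schur_endW.
Proof.
split=> [|s t]; apply: endW_eq => v; first exact: lact1.
exact: lactM.
Qed.

HB.instance Definition _ :=
  GRing.isZmodMorphism.Build _ _ schur_endW schur_endW_zm.
HB.instance Definition _ :=
  GRing.isMonoidMorphism.Build _ _ schur_endW schur_endW_monoid.

Lemma schur_endW_inj : injective schur_endW.
Proof.
move=> s t st; apply/val_inj/lact_faithful => v.
exact: (congr1 (fun f : endW A n d => f v) st).
Qed.

Lemma wact_tract v (a : tpow d A) : wact v (wmk a 1%g) = tract v a.
Proof.
rewrite /wact (bigD1 1%g) //= ffunE eqxx tact1 big1 ?addr0 // => g g1.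
rewrite ffunE (negPf g1).
by rewrite [tract _ _](zm0 (tmul_zmr (colmulr_biadd A n) v)) (zm0 (tact_zm g)).
Qed.

Lemma wact_tact v (g : 'S_d) : wact v (wmk 1 g) = tact g v.
Proof.
rewrite /wact (bigD1 g) //= ffunE eqxx big1 ?addr0 => [|h hg].
  congr tact; apply: (tone_r (colmulr_biadd A n)) => x.
  by apply/matrixP => i j; rewrite mxE mulr1 ord1.
rewrite ffunE (negPf hg).
by rewrite [tract _ _](zm0 (tmul_zmr (colmulr_biadd A n) v)) (zm0 (tact_zm h)).
Qed.

(** The matrix of [f] is invariant because its conjugate by [g] acts as the
    conjugate of [f], which is [f]. *)
Lemma schur_endW_surj f : exists s, schur_endW s = f.
Proof.
have [v a|x xf] := tlinear_lact (endW_zmod f).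
  by rewrite -!wact_tract endW_lin.
have x_inv : x \in @schur_pred A n d.
  apply/schurP => g; apply: lact_faithful => v.
  rewrite -{1}[v]tact1 -(mulgV g) -tactM -tact_lact -xf.
  by rewrite -wact_tact -endW_lin wact_tact tactM mulgV tact1 xf.
by exists (Sub x x_inv); apply: endW_eq => v; rewrite xf.
Qed.

(** The action is even: matrices of parity [b] shift parities by [b], so the
    homogeneous parts of [s] act as the homogeneous parts of its action. *)
Lemma schur_endW_hcomp b s : schur_endW (hcomp b s) = hcomp b (schur_endW s).
Proof.
have hom c : hcomp c (schur_endW (hcomp c s)) = schur_endW (hcomp c s).
  apply/endWhP => e v; apply: (tmul_even (mulmx_biadd A n n 1)).
  exact: (congr1 val (hcomp_id c s)).
rewrite {2}(hcomp_sum s) !raddf_sum /= (bigD1 b) //= hom big1 ?addr0 // => c cb.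
by apply: hcomp_neq (hom c) _; rewrite eq_sym.
Qed.

End SchurAction.

Theorem theorem3 (A : superalgType) (A_free : superfree A)
    (n d : nat) (n_gt0 : (0 < n)%N) :
  (forall (s : schur A n d) (v : tpow d 'cV[A]_n) (w : wreath d A),
     wact (sact s v) w = sact s (wact v w)) /\
  (exists f : {rmorphism schur A n d -> endW A n d},
     [/\ bijective f,
         forall (b : bool) (s : schur A n d), f (hcomp b s) = hcomp b (f s)
       & forall (s : schur A n d) (v : tpow d 'cV[A]_n), f s v = sact s v]).
Proof.
split; first exact: wact_sact.
exists (@schur_endW A n d); split=> //; last exact: schur_endW_hcomp.
have /boolp.choice [h hK] := @schur_endW_surj A n d.
by exists h => // s; apply: schur_endW_inj; rewrite hK.
Qed.
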